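(* Let $M_1,\ldots,M_s$ be $m\times m$ positive semidefinite matrices, let $N\ge 1$ be an integer and let $p\in[0,1]$. Consider the problem $$\max_{\boldsymbol{n}\in\mathbb{N}^s}\ \varphi_p(\boldsymbol{n})\quad\text{subject to}\quad \sum_{i\in[s]}n_i\le N.$$ The greedy algorithm always yields a solution within a factor $1-\frac1e$ of the optimum of this problem; that is, every set $\mathcal{G}_N$ which the greedy algorithm can return satisfies $$\varphi_p(\mathcal{G}_N)\ \ge\ \Big(1-\frac1e\Big)\max\Big\{\varphi_p(\boldsymbol{n}):\ \boldsymbol{n}\in\mathbb{N}^s,\ \sum_{i\in[s]}n_i\le N\Big\}.$$
   Context: $[s]:=\{1,\ldots,s\}$, and $\mathbb{N}$ contains $0$. Positive semidefinite matrices are real symmetric. For $p\in(0,1]$, $\varphi_p(\boldsymbol{n})=\operatorname{trace}\big(\sum_{i\in[s]}n_iM_i\big)^p=\sum_{k=1}^m\lambda_k^p$, where $\lambda_1,\ldots,\lambda_m$ are the eigenvalues of $\sum_i n_iM_i$ counted with multiplicities; for $p=0$, $\varphi_0(\boldsymbol{n})=\operatorname{rank}\big(\sum_{i\in[s]}n_iM_i\big)$ (so that the problem is rank maximization). Let $E$ be the pool containing $N$ copies of each index $i\in[s]$. A subset $S\subseteq E$ corresponds to the vector $\boldsymbol{n}\in\mathbb{N}^s$ for which $n_i$ is the number of copies of $i$ in $S$, and $\varphi_p(S):=\varphi_p(\boldsymbol{n})$. The greedy algorithm starts from $\mathcal{G}_0=\emptyset$ and sets $\mathcal{G}_{k+1}:=\mathcal{G}_k\cup\{i_k\}$,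 where $i_k\in\operatorname{argmax}_{i\in E\setminus\mathcal{G}_k}\varphi_p(\mathcal{G}_k\cup\{i\})$ (ties broken arbitrarily), until $k=N$; it returns $\mathcal{G}_N$. *)

(* Defs.v *)
From HB Require Import structures.
From mathcomp Require Import all_boot all_order all_algebra.
From mathcomp Require Import boolp classical_sets reals exp.
From mathcomp Require Import complex.

Set Implicit Arguments.
Unset Strict Implicit.
Unset Printing Implicit Defensive.

Import Order.TTheory GRing.Theory Num.Theory.
Local Open Scope ring_scope.

Definition psdmx (R : realType) (m : nat) (A : 'M[R]_m) : Prop :=
  A^T = A /\ forall x : 'cV[R]_m, 0 <= (x^T *m A *m x) 0 0.

Definition is_spectrum (R : realType) (m : nat) (A : 'M[R]_m) (l : seq R) :
  Prop := char_poly A = \prod_(a <- l) ('X - a%:P).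

(* The order of the list is unspecified. If the characteristic polynomial does
   not split over R the value is [::]; by [spectrumP] below this does not happen
   for symmetric matrices. *)
Definition spectrum (R : realType) (m : nat) (A : 'M[R]_m) : seq R :=
  xget [::] [set l | is_spectrum A l]%classic.

Definition weighted_sum (R : realType) (m s : nat) (M : 'I_s -> 'M[R]_m)
  (n : {ffun 'I_s -> nat}) : 'M[R]_m := \sum_(i < s) M i *+ n i.

(* For p != 0 one has 0 `^ p = 0, so null eigenvalues contribute nothing. *)
Definition phi (R : realType) (m s : nat) (M : 'I_s -> 'M[R]_m) (p : R)
  (n : {ffun 'I_s -> nat}) : R :=
  if p == 0 then (\rank (weighted_sum M n))%:R
  else \sum_(a <- spectrum (weighted_sum M n)) a `^ p.

(* The pool is 'I_s * 'I_N: the pair (i, j) is the j-th copy of the index i. *)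
Definition copies (s N : nat) (S : {set 'I_s * 'I_N}) : {ffun 'I_s -> nat} :=
  [ffun i => #|[set e in S | e.1 == i]|].

Definition phi_set (R : realType) (m s N : nat) (M : 'I_s -> 'M[R]_m) (p : R)
  (S : {set 'I_s * 'I_N}) : R := phi M p (copies S).

(* [greedy M p k G]: some tie-breaking lets the algorithm be in state G after
   k steps. *)
Inductive greedy (R : realType) (m s N : nat) (M : 'I_s -> 'M[R]_m) (p : R) :
  nat -> {set 'I_s * 'I_N} -> Prop :=
| greedy_start : greedy M p 0 finset.set0
| greedy_step (k : nat) (G : {set 'I_s * 'I_N}) (e : 'I_s * 'I_N) :
    greedy M p k G ->
    e \notin G ->
    (forall e' : 'I_s * 'I_N, e' \notin G ->
       phi_set M p (e' |: G) <= phi_set M p (e |: G)) ->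
    greedy M p k.+1 (e |: G).

Definition feasible (s N : nat) : set {ffun 'I_s -> nat} :=
  [set n | (\sum_(i < s) n i <= N)%N]%classic.
Arguments feasible : clear implicits.

Definition is_max (R : realType) (A : set R) (x : R) : Prop :=
  A x /\ ubound A x.

Lemma spectrumP (R : realType) (m : nat) (A : 'M[R]_m) :
  A^T = A -> is_spectrum A (spectrum A).
Proof.
move=> symA; apply: (@xgetPex _ [::] [set l | is_spectrum A l]%classic).
pose C : numClosedFieldType := complex.complex R.
pose f : {rmorphism R -> C} := complex.real_complex R.
have fJ (x : R) : (f x)^* = f x by apply: complex.conjc_real.
have [r Er] := closed_field_poly_normal (char_poly (map_mx f A) : {poly C}).
rewrite (monicP (char_poly_monic _)) scale1r in Er.
have r_real z : z \in r -> z = f (complex.Re z).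
  move=> rz; have : eigenvalue (map_mx f A) z.
    by rewrite eigenvalue_root_char Er root_prod_XsubC.
  case/eigenvalueP => v vA v0.
  pose w : 'cV[C]_m := (map_mx Num.conj v)^T.
  have q_neq0 : (v *m w) 0 0 != 0.
    apply: contra v0; rewrite mxE => /eqP q0; apply/eqP/rowP => j.
    have w_ge0 (k : 'I_m) : 0 <= v 0 k * w k 0 by rewrite !mxE mul_conjC_ge0.
    have /eqP : v 0 j * w j 0 = 0.
      exact: (psumr_eq0P (fun k _ => w_ge0 k) q0).
    by rewrite !mxE mul_conjC_eq0 => /eqP.
  have wA : map_mx f A *m w = z^* *: w.
    rewrite /w -[map_mx f A]trmxK -trmx_mul map_trmx symA.
    have -> : map_mx f A = map_mx Num.conj (map_mx f A).
      by apply/matrixP => i j; rewrite !mxE fJ.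
    by rewrite -map_mxM vA map_mxZ linearZ.
  have zq : z * (v *m w) 0 0 = z^* * (v *m w) 0 0.
    have := congr1 (fun B : 'M_1 => B 0 0) (mulmxA v (map_mx f A) w).
    by rewrite wA vA -scalemxAl -scalemxAr [LHS]mxE [RHS]mxE => ->.
  apply/esym/complex.RRe_real/CrealP/esym.
  exact: (mulIf q_neq0 zq).
exists (map (@complex.Re R) r).
rewrite /is_spectrum /=; apply: (map_poly_inj f).
rewrite map_char_poly Er rmorph_prod big_map big_seq [RHS]big_seq.
apply: eq_bigr => z /r_real Ez.
by rewrite rmorphB /= map_polyX map_polyC /= -Ez.
Qed.

(* Main.v *)
Require Import Defs.
From mathcomp Require Import all_boot all_order all_algebra.
From mathcomp Require Import boolp classical_sets reals sequences exp.
From mathcomp Require Import fsbigop ereal normedtype esum.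
From mathcomp Require Import ring lra.

Import Order.TTheory GRing.Theory Num.Theory.
Local Open Scope ring_scope.

(** Write F(A) for trace(A^p). Everything rests on monotonicity and on the
    submodular inequality F(A+B+C) + F(A) <= F(A+B) + F(A+C) for positive
    semidefinite A, B, C. For p = 0 it is the modular law of subspace
    dimensions, and for p = 1 the trace is additive. For 0 < p < 1, the
    determinant satisfies det(P+B+C) det P <= det(P+B) det(P+C) for positive
    definite P: adding a rank one term v v^T to P multiplies det P by
    1 + v^T P^-1 v, and P^-1 decreases when P grows. Applied to P = 1 + tA, this
    is submodularity of the sum of ln(1 + t a) over the eigenvalues a of A. The
    function a^p lies in the closed cone generated by the a |-> ln(1 + t a):
    the series of the u^-k ln(1 + q^k a) over all integers k, where q^p = u > 1,
    is multiplied by u when a is multiplied by q, hence is a constant multiple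
    of a^p up to a factor u, and u tends to 1.

    Each greedy step then closes at least the fraction 1/N of the gap to the
    optimum, and (1 - 1/N)^N <= 1/e. *)

(** * Positive semidefinite matrices *)

Section PsdMatrices.

Variables (R : realType) (m : nat).
Implicit Types (A B C P : 'M[R]_m) (x y z v : 'cV[R]_m).

Definition bform A x y : R := (x^T *m A *m y) 0 0.

Lemma bformDl A x y z : bform A (x + y) z = bform A x z + bform A y z.
Proof. by rewrite /bform linearD /= !mulmxDl mxE. Qed.

Lemma bformDr A x y z : bform A z (x + y) = bform A z x + bform A z y.
Proof. by rewrite /bform mulmxDr mxE. Qed.

Lemma bformZl A a x y : bform A (a *: x) y = a * bform A x y.
Proof. by rewrite /bform linearZ /= -!scalemxAl mxE. Qed.

Lemma bformZr A a x y : bform A x (a *: y) = a * bform A x y.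
Proof. by rewrite /bform -scalemxAr mxE. Qed.

Lemma bformDm A B x y : bform (A + B) x y = bform A x y + bform B x y.
Proof. by rewrite /bform mulmxDr mulmxDl mxE. Qed.

Lemma bformC A x y : A^T = A -> bform A x y = bform A y x.
Proof.
move=> symA; rewrite /bform.
have <- : (y^T *m A *m x)^T = x^T *m A *m y.
  by rewrite !trmx_mul trmxK symA mulmxA.
by rewrite [LHS]mxE.
Qed.

Lemma bform_rank1 v x y :
  bform (v *m v^T) x y = (v^T *m x) 0 0 * (v^T *m y) 0 0.
Proof.
rewrite /bform mulmxA -mulmxA [LHS]mxE big_ord1; congr (_ * _).
have <- : (v^T *m x)^T = x^T *m v by rewrite trmx_mul trmxK.
by rewrite [LHS]mxE.
Qed.

Lemma bform_delta A (i j : 'I_m) :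
  bform A (delta_mx i 0) (delta_mx j 0) = A i j.
Proof.
by rewrite /bform trmx_delta -rowE -(colE j (row i A)) !mxE.
Qed.

Lemma psdmx_bform_ge0 A x : psdmx A -> 0 <= bform A x x.
Proof. by case=> _; apply. Qed.

Lemma psdmx0 : psdmx (0 : 'M[R]_m).
Proof.
by split=> [|x]; [rewrite linear0 | rewrite mulmx0 mul0mx mxE].
Qed.

Lemma psdmx1 : psdmx (1%:M : 'M[R]_m).
Proof.
split=> [|x]; first exact: tr_scalar_mx.
by rewrite mulmx1 mxE sumr_ge0 // => i _; rewrite mxE -expr2 sqr_ge0.
Qed.

Lemma psdmxD A B : psdmx A -> psdmx B -> psdmx (A + B).
Proof.
move=> psdA psdB; split=> [|x].
  by rewrite linearD /= psdA.1 psdB.1.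
by rewrite -/(bform _ x x) bformDm addr_ge0 // psdmx_bform_ge0.
Qed.

Lemma psdmxZ a A : 0 <= a -> psdmx A -> psdmx (a *: A).
Proof.
move=> a0 psdA; split=> [|x]; first by rewrite linearZ /= psdA.1.
by rewrite -scalemxAr -scalemxAl mxE mulr_ge0 // (psdmx_bform_ge0 A x).
Qed.

Lemma psdmx_rank1 v : psdmx (v *m v^T).
Proof.
split=> [|x]; first by rewrite trmx_mul trmxK.
by rewrite -/(bform _ x x) bform_rank1 -expr2 sqr_ge0.
Qed.

(** Degenerate case of Cauchy-Schwarz. With b = x^T A y and c = y^T A y, the form at (c + 1) x - b y
    equals - b^2 (c + 2), and it must be nonnegative. *)
Lemma psdmx_isotropic A x y : psdmx A -> bform A x x = 0 -> bform A x y = 0.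
Proof.
move=> psdA xx0; set b := bform A x y.
have c0 := psdmx_bform_ge0 A y psdA; set c := bform A y y in c0.
have := psdmx_bform_ge0 A ((c + 1) *: x + (- b) *: y) psdA.
rewrite !(bformDl, bformDr, bformZl, bformZr) xx0 (bformC A y x psdA.1).
rewrite -/b -/c => h.
have : b ^+ 2 * (c + 2) <= 0 by rewrite expr2; lra.
rewrite pmulr_lle0; last by lra.
by rewrite le_eqVlt ltNge sqr_ge0 orbF sqrf_eq0 => /eqP.
Qed.

Lemma psdmx_diag_eq0 A : psdmx A -> (forall i, A i i = 0) -> A = 0.
Proof.
move=> psdA dA; apply/matrixP => i j.
rewrite -bform_delta psdmx_isotropic ?mxE //.
by rewrite bform_delta dA.
Qed.

(* Subtracting (A e_i)(A e_i)^T / A_ii keeps A positive semidefinite and kills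
   the i-th diagonal entry without reviving the others. *)
Lemma psdmx_rank1_ind (K : 'M[R]_m -> Prop) :
  K 0 -> (forall A v, psdmx A -> K A -> K (A + v *m v^T)) ->
  forall A, psdmx A -> K A.
Proof.
move=> K0 KD A; have [k] := ubnP #|[pred i | A i i != 0]|.
elim: k A => // k IHk A; rewrite ltnS => leAk psdA.
have [/existsP[i Ai]|] := boolP [exists i, A i i != 0]; last first.
  rewrite negb_exists => /forallP dA; rewrite (psdmx_diag_eq0 A psdA) // => i.
  by have := dA i; rewrite negbK => /eqP.
have Aii_gt0 : 0 < A i i.
  by rewrite lt_neqAle eq_sym Ai -bform_delta psdmx_bform_ge0.
pose e : 'cV[R]_m := delta_mx i 0.
have eE : bform A e e = A i i by rewrite bform_delta.
pose v := (Num.sqrt (A i i))^-1 *: (A *m e).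
have vE x : (v^T *m x) 0 0 = (Num.sqrt (A i i))^-1 * bform A e x.
  by rewrite /v linearZ /= trmx_mul psdA.1 -scalemxAl mxE.
pose B := A - v *m v^T.
have BE x y : bform B x y
    = bform A x y - (A i i)^-1 * (bform A e x * bform A e y).
  have {1}-> : A = B + v *m v^T by rewrite subrK.
  rewrite [in RHS]bformDm bform_rank1 !vE.
  rewrite -[X in X^-1 * (bform A e x * _)](sqr_sqrtr (ltW Aii_gt0)).
  by field; rewrite sqrtr_eq0 -ltNge.
have psdB : psdmx B.
  split=> [|x]; first by rewrite linearB /= psdA.1 (psdmx_rank1 v).1.
  rewrite -/(bform B x x) BE.
  (* The form of B at x is the form of A at the component of x orthogonal to e with respect to A. *)
  have := psdmx_bform_ge0 A (x + (- (bform A e x / A i i)) *: e) psdA.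
  rewrite !(bformDl, bformDr, bformZl, bformZr) (bformC A x e psdA.1).
  rewrite eE; congr (0 <= _).
  by field.
rewrite -[A](subrK (v *m v^T)); apply: KD => //; apply: IHk => //.
apply: leq_trans leAk; apply: proper_card; apply/properP; split; last first.
  by exists i; rewrite !inE // negbK -bform_delta BE eE mulKf // subrr.
apply/fintype.subsetP => j; rewrite !inE; apply: contra => /eqP Aj.
rewrite -bform_delta BE bform_delta Aj (bformC A e _ psdA.1).
by rewrite psdmx_isotropic ?bform_delta // mul0r mulr0 subrr.
Qed.

(** The bordered matrix [X] factors in two ways into block triangular matrices; comparing the two
    resulting determinants gives the formula. *)
Lemma det_rank1_update P v :
  P \in unitmx ->
  \det (P + v *m v^T) = \det P * (1 + bform (invmx P) v v).
Proof.
move=> Pu.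
pose X : 'M_(m + 1) := block_mx P (- v) v^T 1%:M.
have X1 : X = block_mx 1%:M (- v) 0 1%:M *m block_mx (P + v *m v^T) 0 v^T 1%:M.
  rewrite mulmx_block !(mul1mx, mulmx1, mul0mx, mulmx0, addr0, add0r, mulNmx).
  by rewrite addrK.
pose d := 1%:M + v^T *m invmx P *m v.
have X2 : X = block_mx P 0 v^T 1%:M *m block_mx 1%:M (- (invmx P *m v)) 0 d.
  rewrite mulmx_block !(mul1mx, mulmx1, mul0mx, mulmx0, addr0, add0r, mulmxN).
  by rewrite mulKVmx // /d mulmxA addrCA addNr addr0.
have := congr1 determinant X1; rewrite X2 !det_mulmx !(det_lblock, det_ublock).
rewrite !det1 !(mul1r, mulr1) => <-; congr (_ * _).
by rewrite det_mx11 /d mxE [X in X + _]mxE.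
Qed.

(** Positive definiteness, stated through the determinant because this is the quantity followed
    along rank one updates; it also gives invertibility at once. *)
Definition pdmx P := psdmx P /\ 0 < \det P.

Lemma pdmx_unit P : pdmx P -> P \in unitmx.
Proof. by case=> _ d0; rewrite unitmxE unitfE gt_eqF. Qed.

Lemma trmx_invmx P : P^T = P -> (invmx P)^T = invmx P.
Proof. by move=> symP; rewrite trmx_inv symP. Qed.

Lemma bform_invmx P v :
  pdmx P -> bform (invmx P) v v = bform P (invmx P *m v) (invmx P *m v).
Proof.
move=> pdP; rewrite /bform trmx_mul (trmx_invmx _ pdP.1.1).
by rewrite -!mulmxA mulKVmx ?pdmx_unit.
Qed.

Lemma bform_invmx_ge0 P v : pdmx P -> 0 <= bform (invmx P) v v.
Proof.
by move=> pdP; rewrite bform_invmx // psdmx_bform_ge0 //; exact: pdP.1.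
Qed.

Lemma psdmx_det_mono P C :
  pdmx P -> psdmx C -> pdmx (P + C) /\ \det P <= \det (P + C).
Proof.
move=> pdP; move: C; apply: psdmx_rank1_ind => [|C v psdC [pdPC leP]].
  by rewrite addr0.
rewrite addrA.
have lePC : \det (P + C) <= \det (P + C + v *m v^T).
  rewrite det_rank1_update ?pdmx_unit // ler_peMr ?(ltW pdPC.2) //.
  by rewrite lerDl bform_invmx_ge0.
split; last exact: le_trans lePC.
split; last exact: lt_le_trans pdPC.2 lePC.
by apply: psdmxD pdPC.1 (psdmx_rank1 v).
Qed.

(** Put x = Q^-1 v and y = P^-1 v, where Q = P + B. Then x^T P y = x^T v = x^T Q x, so expanding the
    form of P at y - x gives y^T P y >= 2 x^T Q x - x^T P x >= x^T Q x. *)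
Lemma bform_invmx_antimono P B v :
  pdmx P -> psdmx B -> bform (invmx (P + B)) v v <= bform (invmx P) v v.
Proof.
move=> pdP psdB; have [pdQ _] := psdmx_det_mono P B pdP psdB.
set Q := P + B in pdQ *.
rewrite !bform_invmx //; set x := invmx Q *m v; set y := invmx P *m v.
have xPy : bform P x y = bform Q x x.
  by rewrite /bform -!mulmxA !mulKVmx ?pdmx_unit.
have := psdmx_bform_ge0 P (y + (-1) *: x) pdP.1.
rewrite !(bformDl, bformDr, bformZl, bformZr) (bformC P y x pdP.1.1) xPy.
have : bform P x x <= bform Q x x by rewrite bformDm lerDl psdmx_bform_ge0.
by lra.
Qed.

(** Build C from rank one terms. A term v v^T multiplies the left side by 1 + v^T (P + B + C)^-1 v
    and the right side by 1 + v^T (P + C)^-1 v, which is at least as large. *)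
Lemma det_submodular P B C : pdmx P -> psdmx B -> psdmx C ->
  \det (P + B + C) * \det P <= \det (P + B) * \det (P + C).
Proof.
move=> pdP psdB; move: C; apply: psdmx_rank1_ind => [|C v psdC IH].
  by rewrite !addr0.
have [pdPC _] := psdmx_det_mono P C pdP psdC.
have [pdPCB _] := psdmx_det_mono _ B pdPC psdB.
have := bform_invmx_antimono (P + C) B v pdPC psdB.
rewrite [P + C + B]addrAC in pdPCB *; rewrite !addrA.
rewrite !det_rank1_update ?pdmx_unit // => h.
rewrite mulrAC mulrA; apply: ler_pM => //.
- by rewrite mulr_ge0 ?ltW // ?pdPCB.2 ?pdP.2.
- by rewrite addr_ge0 // bform_invmx_ge0.
- by rewrite lerD2l.
Qed.

(** If (A + B) w = 0, the nonnegative numbers w^T A w and w^T B w sum to 0, so w is isotropic for A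
    and A w = 0. This is applied to the columns of the cokernel of A + B. *)
Lemma psdmx_sub_addl A B : psdmx A -> psdmx B -> (A <= (A + B)%R)%MS.
Proof.
move=> psdA psdB; rewrite submxE; apply/eqP/matrixP => i j.
set w := col j (cokermx (A + B)%R).
have w0 : (A + B) *m w = 0 by rewrite /w colE mulmxA mulmx_coker mul0mx.
have Aw : bform A w w = 0.
  have : bform (A + B) w w = 0 by rewrite /bform -mulmxA w0 mulmx0 mxE.
  rewrite bformDm => /eqP; rewrite paddr_eq0 ?psdmx_bform_ge0 //.
  by case/andP => /eqP.
rewrite [RHS]mxE.
have <- : bform A (delta_mx i 0) w = (A *m cokermx (A + B)%R) i j.
  rewrite /bform trmx_delta -mulmxA -rowE /w colE mulmxA -colE.
  by rewrite !mxE.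
by rewrite (bformC _ _ _ psdA.1) psdmx_isotropic.
Qed.

Lemma psdmx_eq_addsmx A B :
  psdmx A -> psdmx B -> ((A + B)%R :=: A + B)%MS.
Proof.
move=> psdA psdB; apply/eqmxP; rewrite addmx_sub_adds //= addsmx_sub.
by rewrite psdmx_sub_addl // addrC psdmx_sub_addl.
Qed.

Lemma rank_psdmx_mono A B :
  psdmx A -> psdmx B -> (\rank A <= \rank (A + B)%R)%N.
Proof. by move=> psdA psdB; rewrite mxrankS // psdmx_sub_addl. Qed.

(** The row spaces of A + B and A + C together span that of A + B + C, and their intersection
    contains that of A. *)
Lemma rank_psdmx_submodular A B C : psdmx A -> psdmx B -> psdmx C ->
  (\rank (A + B + C)%R + \rank A <= \rank (A + B)%R + \rank (A + C)%R)%N.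
Proof.
move=> psdA psdB psdC; rewrite -[leqRHS]mxrank_sum_cap.
apply: leq_add; apply: mxrankS; last first.
  by rewrite sub_capmx !psdmx_sub_addl.
rewrite psdmx_eq_addsmx //; last exact: psdmxD.
by rewrite addsmxS // addrC psdmx_sub_addl.
Qed.

End PsdMatrices.

Arguments pdmx {R m}.
Arguments bform {R m}.

(** * Powers as limits of sums of logarithms *)

Lemma esumZl (R : realType) (T : choiceType) (S : set T) (c : R)
    (a : T -> \bar R) :
  0 < c -> (forall i, 0 <= a i)%E ->
  (\esum_(i in S) (c%:E * a i) = c%:E * \esum_(i in S) a i)%E.
Proof.
move=> c0 a0; rewrite /esum.
rewrite -ereal_supZl ?(ltW c0) //; last first.
  apply/set0P; exists 0%E; exists set0; first exact: fsets_set0.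
  by rewrite fsbig_set0.
congr ereal_sup; apply/seteqP; split=> [_ [X fX <-]|_ [_ [X fX <-] <-]] /=.
  by exists (\sum_(i \in X) a i)%E; [exists X | rewrite ge0_mule_fsumr].
by exists X => //; rewrite ge0_mule_fsumr.
Qed.

Lemma esum_geometric_lty (R : realType) (a : nat -> R) (C r : R) :
  0 <= C -> 0 < r < 1 -> (forall n, 0 <= a n <= C * r ^+ n) ->
  (\esum_(n in [set: nat]) (a n)%:E < +oo)%E.
Proof.
move=> C0 /andP[r0 r1] aC.
have a0 n : (0 <= (a n)%:E)%E by rewrite lee_fin; case/andP: (aC n).
rewrite -nneseries_esumT //.
apply: le_lt_trans (ltry (C * (1 - r)^-1)).
apply: lime_le; first exact: is_cvg_nneseries.
apply: nearW => n; rewrite sumEFin lee_fin.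
have r1' : `|r| < 1 by rewrite gtr0_norm.
apply: le_trans (geometric_le_lim n C0 r0 r1').
by rewrite /series /=; apply: ler_sum => i _; case/andP: (aC i).
Qed.

Lemma bernoulli_ineq (R : realDomainType) (w : R) (n : nat) :
  1 <= w -> n%:R * (w - 1) <= w ^+ n.
Proof.
move=> w1; apply: le_trans (_ : w ^+ n - 1 <= _); last by lra.
rewrite subrX1 mulrC ler_wpM2l ?subr_ge0 //.
rewrite -[n in n%:R]card_ord -sum1_card natr_sum ler_sum // => i _.
by rewrite exprn_ege1.
Qed.

Section LogSeries.

Variables (R : realType) (p u : R).
Hypotheses (p_gt0 : 0 < p) (p_lt1 : p < 1) (u_gt1 : 1 < u).

Let q := u `^ p^-1.

Let u_gt0 : 0 < u. Proof. exact: lt_trans u_gt1. Qed.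

Let q_gt0 : 0 < q. Proof. exact: powR_gt0. Qed.

Let powR_q_expz (k : int) : (q ^ k) `^ p = u ^ k.
Proof.
rewrite -!powR_intmul ?(ltW q_gt0) ?(ltW u_gt0) // -!powRrM.
by congr (_ `^ _); field; rewrite gt_eqF.
Qed.

(** The assumption p < 1 enters here: it makes the terms of negative index decay geometrically with
    ratio u / q. *)
Let u_lt_q : u < q.
Proof.
have : 1 < p^-1 by rewrite invf_gt1.
rewrite -subr_gt0 => d0.
rewrite /q -[p^-1](subrK 1) powRD; last by apply/implyP => _; rewrite gt_eqF.
rewrite powRr1 ?(ltW u_gt0) // ltr_pMl //.
by rewrite /powR gt_eqF // expR_gt1 mulr_gt0 // ln_gt0.
Qed.

Let q_gt1 : 1 < q. Proof. exact: lt_trans u_lt_q. Qed.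

Let term (x : R) (k : int) : R := u ^ (- k) * ln (1 + q ^ k * x).

Let term_ge0 x k : 0 <= x -> 0 <= term x k.
Proof.
move=> x0; rewrite mulr_ge0 ?exprz_ge0 ?(ltW u_gt0) // ln_ge0 // lerDl.
by rewrite mulr_ge0 ?exprz_ge0 ?(ltW q_gt0).
Qed.

(** With extended real values, reindexing and comparison need no summability. Finiteness is shown at
    1 and carried to other points by shifts and monotonicity. *)
Let logseries (x : R) : \bar R := (\esum_(k in [set: int]) (term x k)%:E)%E.

Let logseries_shift x (j : int) : 0 <= x ->
  logseries (q ^ j * x) = ((u ^ j)%:E * logseries x)%E.
Proof.
move=> x0; rewrite /logseries.
rewrite [in RHS](reindex_esum [set: int] _ (fun k => k + j)); last first.
  split=> // [k l _ _ /addIr //|k _].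
  by exists (k - j) => //; rewrite subrK.
rewrite -esumZl ?exprz_gt0 //; last by move=> k; rewrite lee_fin term_ge0.
apply: eq_esum => k _; rewrite -EFinM /term; congr (_%:E).
rewrite [in RHS]mulrA -[in RHS]expfzDr ?gt_eqF // opprD addrCA subrr addr0.
by rewrite mulrA -expfzDr ?gt_eqF.
Qed.

Let logseries_mono x y : 0 <= x -> x <= y -> (logseries x <= logseries y)%E.
Proof.
move=> x0 xy; apply: le_esum => k _; rewrite lee_fin.
rewrite ler_wpM2l ?exprz_ge0 ?(ltW u_gt0) // ler_ln ?posrE.
- by rewrite lerD2l ler_wpM2l // exprz_ge0 // ltW.
- by rewrite ltr_pwDl ?mulr_ge0 ?exprz_ge0 ?(ltW q_gt0).
- by rewrite ltr_pwDl ?mulr_ge0 ?exprz_ge0 ?(ltW q_gt0) ?(le_trans x0).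
Qed.

Let logseries1_lty : (logseries 1 < +oo)%E.
Proof.
rewrite /logseries (esumID (range Posz)); last first.
  by move=> k _; rewrite lee_fin term_ge0.
rewrite setTI setTI.
have -> : (~` range Posz)%classic = range Negz.
  apply/seteqP; split=> [[n nP|n _]|_ [n _ <-]] //=.
  - by case: nP; exists n.
  - by exists n.
  - by case.
rewrite !esum_image; [|by move=> ? ? _ _ []..].
have q1 := q_gt1; have u1 := u_gt1.
apply: lte_add_pinfty.
  (* Nonnegative indices: u^-n is the product of two factors w^-n, one absorbing the linear growth
     of ln (1 + q^n), the other left as the geometric ratio. *)
  pose w := Num.sqrt u.
  have w1 : 1 < w by rewrite -sqrtr1 ltr_sqrt.
  have uE : u = w ^+ 2 by rewrite sqr_sqrtr ?(ltW u_gt0).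
  have w0 : 0 < w by apply: lt_trans w1.
  (* From ln (1 + q^n) <= ln 2 + n ln q, together with 1 <= w^n and n (w - 1) <= w^n. *)
  pose C := ln 2 + ln q / (w - 1).
  have lnq : 0 <= ln q by rewrite ln_ge0 ?ltW.
  have ln2 : 0 <= ln (2 : R) by rewrite ln_ge0 // ler1n.
  have C0 : 0 <= C by rewrite addr_ge0 // divr_ge0 // subr_ge0 ltW.
  apply: (@esum_geometric_lty _ _ C w^-1) => //.
    by rewrite invr_gt0 w0 invf_lt1.
  move=> n; rewrite term_ge0 //= /term mulr1.
  have wn : 0 < w ^+ n by rewrite exprn_gt0.
  have -> : u ^ (- n%:Z) = w^-1 ^+ n * w^-1 ^+ n.
    by rewrite -exprnN uE -exprM mulnC exprM expr2 exprVn -invfM.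
  rewrite mulrC mulrA ler_wpM2r ?exprn_ge0 ?invr_ge0 ?(ltW w0) //.
  rewrite exprVn ler_pdivrMr // -exprnP.
  have qn : 1 <= q ^+ n by rewrite exprn_ege1 // ltW.
  apply: (@le_trans _ _ (ln (2 * q ^+ n))).
    by rewrite ler_ln ?posrE; lra.
  rewrite lnM ?posrE //; last by lra.
  rewrite lnXn // mulrDl lerD //.
    by rewrite ler_peMr // exprn_ege1 // ltW.
  rewrite -mulr_natr -mulrA ler_wpM2l // mulrC ler_pdivlMr ?subr_gt0 //.
  exact: bernoulli_ineq (ltW w1).
(* Negative indices: [Negz n] is - (n + 1), so ln (1 + y) <= y bounds the term by (u / q)^(n + 1),
   hence the leading constant u / q. *)
have r0 : 0 < u / q by rewrite divr_gt0.
apply: (@esum_geometric_lty _ _ (u / q) (u / q)); first exact: ltW.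
  by rewrite r0 ltr_pdivrMr // mul1r.
move=> n; rewrite term_ge0 //= /term mulr1 NegzE opprK -exprS.
have qn : 0 < q ^ (- n.+1%:Z) by rewrite exprz_gt0.
rewrite expr_div_n -exprnP exprnN ler_wpM2l ?exprn_ge0 ?(ltW u_gt0) //.
by rewrite le_ln1Dx //; lra.
Qed.

Let c := fine (logseries 1).

Let logseries1 : logseries 1 = c%:E.
Proof.
rewrite /c fineK // ge0_fin_numE ?logseries1_lty //.
by apply: esum_ge0 => k _; rewrite lee_fin term_ge0.
Qed.

Let c_gt0 : 0 < c.
Proof.
rewrite -lte_fin -logseries1.
have t0 : 0 < term 1 0 by rewrite /term mul1r mulr1 ln_gt0 //; lra.
apply: (@lt_le_trans _ _ (term 1 0)%:E); first by rewrite lte_fin.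
apply: esum_ge; exists [set 0%R]%classic; last by rewrite fsbig_set1.
by split.
Qed.

Let logseries0 : logseries 0 = 0%E.
Proof. by apply: esum1 => k _; rewrite /term mulr0 addr0 ln1 mulr0. Qed.

Let exp_bracket x : 0 < x -> exists j : int, q ^ j <= x <= q ^ (j + 1).
Proof.
move=> x0; have lnq : 0 < ln q by rewrite ln_gt0.
have qE k : q ^ k = expR (k%:~R * ln q).
  by rewrite -powR_intmul ?(ltW q_gt0) // /powR gt_eqF.
exists (Num.floor (ln x / ln q)); rewrite !qE -{2 3}[x]lnK ?posrE // !ler_expR.
have /andP[h1 h2] := floor_itv (ln x / ln q).
by rewrite -ler_pdivlMr // h1 -ler_pdivrMr // ltW.
Qed.

(** For q^j <= x <= q^(j + 1), the series at x lies between c u^j and c u^(j + 1), and so does c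
    x^p; the two differ by a factor at most u. *)
Let logseries_bounds x : 0 <= x ->
  ((c / u * x `^ p)%:E <= logseries x <= (c * u * x `^ p)%:E)%E.
Proof.
rewrite le_eqVlt => /predU1P[<-|x0].
  by rewrite logseries0 powR0 ?gt_eqF // !mulr0 lexx.
have [j /andP[jx xj]] := exp_bracket x x0.
have Lq k : logseries (q ^ k) = (c * u ^ k)%:E.
  by rewrite -[q ^ k]mulr1 logseries_shift // logseries1 -EFinM mulrC.
have uj : u ^ (j + 1) = u * u ^ j by rewrite expfzDr ?gt_eqF // mulrC.
have q0 k : 0 <= q ^ k by rewrite exprz_ge0 ?ltW.
have jxp : u ^ j <= x `^ p.
  by rewrite -powR_q_expz ge0_ler_powR ?nnegrE ?(ltW p_gt0) ?(ltW x0).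
have xjp : x `^ p <= u * u ^ j.
  by rewrite -uj -powR_q_expz ge0_ler_powR ?nnegrE ?(ltW p_gt0) ?(ltW x0).
apply/andP; split.
  apply: le_trans (logseries_mono _ _ (q0 j) jx); rewrite Lq lee_fin.
  by rewrite -mulrA ler_wpM2l ?(ltW c_gt0) // mulrC ler_pdivrMr // mulrC.
apply: le_trans (logseries_mono _ _ (ltW x0) xj) _; rewrite Lq lee_fin uj.
by rewrite mulrA ler_wpM2l // mulr_ge0 ?ltW.
Qed.

(** The hypothesis at the scales t = q^k, weighted by u^-k and summed over k, compares the series.
    Passing from powers to series and back costs a factor u each time. *)
Lemma sum_powR_le_near (l l' : seq R) :
  {in l, forall a, 0 <= a} -> {in l', forall a, 0 <= a} ->
  (forall t, 0 < t ->
     \sum_(a <- l) ln (1 + t * a) <= \sum_(a <- l') ln (1 + t * a)) ->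
  \sum_(a <- l) a `^ p <= u ^+ 2 * \sum_(a <- l') a `^ p.
Proof.
move=> l0 l0' ll'.
have sumE (r : seq R) : {in r, forall a, 0 <= a} ->
    (\sum_(a <- r) logseries a
     = \esum_(k in [set: int]) (\sum_(a <- r) term a k)%:E)%E.
  move=> r0; rewrite /logseries big_seq -esum_sum; last first.
    by move=> k a _ ar; rewrite lee_fin term_ge0 // r0.
  by apply: eq_esum => k _; rewrite -big_seq sumEFin.
have h1 : ((c / u * \sum_(a <- l) a `^ p)%:E <= \sum_(a <- l) logseries a)%E.
  rewrite mulr_sumr -sumEFin big_seq [leRHS]big_seq; apply: lee_sum => a al.
  by have /andP[] := logseries_bounds a (l0 a al).
have h2 : (\sum_(a <- l') logseries a <= (c * u * \sum_(a <- l') a `^ p)%:E)%E.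
  rewrite mulr_sumr -sumEFin big_seq [leRHS]big_seq; apply: lee_sum => a al.
  by have /andP[] := logseries_bounds a (l0' a al).
have h3 : (\sum_(a <- l) logseries a <= \sum_(a <- l') logseries a)%E.
  rewrite !sumE //; apply: le_esum => k _; rewrite lee_fin -!mulr_sumr.
  by rewrite ler_wpM2l ?exprz_ge0 ?(ltW u_gt0) // ll' // exprz_gt0.
have := le_trans h1 (le_trans h3 h2); rewrite lee_fin -!mulrA ler_pM2l //.
by rewrite ler_pdivrMl // mulrA -expr2.
Qed.

End LogSeries.

Lemma sum_powR_le (R : realType) (p : R) (l l' : seq R) :
  0 < p < 1 ->
  {in l, forall a, 0 <= a} -> {in l', forall a, 0 <= a} ->
  (forall t, 0 < t ->
     \sum_(a <- l) ln (1 + t * a) <= \sum_(a <- l') ln (1 + t * a)) ->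
  \sum_(a <- l) a `^ p <= \sum_(a <- l') a `^ p.
Proof.
move=> /andP[p0 p1] l0 l0' ll'; set B := \sum_(a <- l') _.
have B0 : 0 <= B by rewrite sumr_ge0 // => a _; rewrite powR_ge0.
apply/ler_addgt0Pr => e e0.
(* Chosen so that the excess (v - 1) B is at most e, with B + 1 avoiding a division by 0. The base
   used is the square root of v because the loss is a square. *)
pose v := 1 + e / (B + 1).
have d0 : 0 < e / (B + 1) by rewrite divr_gt0 //; lra.
have u1 : 1 < Num.sqrt v by rewrite -sqrtr1 ltr_sqrt /v; lra.
apply: le_trans (sum_powR_le_near _ _ _ p0 p1 u1 l l' l0 l0' ll') _.
rewrite sqr_sqrtr -/B; last by rewrite /v; lra.
rewrite mulrDl mul1r lerD2l mulrAC ler_pdivrMr; last by lra.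
by rewrite ler_wpM2l ?(ltW e0) //; lra.
Qed.

(** * Functions of the spectrum *)

Section SpectralSums.

Variables (R : realType) (m : nat).
Implicit Types (A B C : 'M[R]_m).

Lemma spectrum_ge0 A : psdmx A -> {in spectrum A, forall a, 0 <= a}.
Proof.
move=> psdA a aA; have : eigenvalue A a.
  by rewrite eigenvalue_root_char (spectrumP psdA.1) root_prod_XsubC.
case/eigenvalueP => v vA v0.
have := psdmx_bform_ge0 _ _ A v^T psdA.
rewrite /bform trmxK vA -scalemxAl mxE pmulr_lge0 //.
rewrite lt_neqAle eq_sym mxE sumr_ge0 ?andbT; last first.
  by move=> i _; rewrite mxE -expr2 sqr_ge0.
apply: contra v0 => /eqP vv0; apply/eqP/rowP => i.
have : v 0 i * v^T i 0 = 0.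
  by apply: (psumr_eq0P _ vv0) => // j _; rewrite mxE -expr2 sqr_ge0.
by rewrite !mxE => /eqP; rewrite -expr2 sqrf_eq0 => /eqP.
Qed.

Lemma size_spectrum A : A^T = A -> size (spectrum A) = m.
Proof.
move=> symA; have := size_char_poly A.
by rewrite (spectrumP symA) size_prod_XsubC => -[].
Qed.

Lemma horner_char_poly A x : (char_poly A).[x] = \det (x%:M - A).
Proof.
rewrite /char_poly -[LHS]/(horner_eval x _) -det_map_mx; congr (\det _).
apply/matrixP => i j; rewrite !mxE /= /horner_eval.
by rewrite hornerD hornerN hornerC hornerMn hornerX.
Qed.

Lemma det_spectrum A t : A^T = A -> t != 0 ->
  \det (1%:M + t *: A) = \prod_(a <- spectrum A) (1 + t * a).
Proof.
move=> symA t0.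
(* The determinant becomes (- t)^m times the characteristic polynomial at - 1 / t; the m factors - t
   are then shared out among the m eigenvalues. *)
have -> : 1%:M + t *: A = (- t) *: ((- t^-1)%:M - A).
  rewrite scalerBr scale_scalar_mx mulrNN mulfV // scaleNr opprK //.
rewrite detZ -horner_char_poly (spectrumP symA) horner_prod.
have -> : (- t) ^+ m = (- t) ^+ size (spectrum A) by rewrite size_spectrum.
elim: (spectrum A) => [|a l IH]; first by rewrite !big_nil mulr1.
rewrite !big_cons -IH hornerXsubC /= exprS.
by field.
Qed.

Lemma sum_spectrum A : A^T = A -> \sum_(a <- spectrum A) a = \tr A.
Proof.
move=> symA; have sz := size_spectrum A symA.
(* The trace is read off the coefficient of degree m - 1, so m = 0 is treated apart. *)
have [m0|m_gt0] := posnP m.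
  rewrite (size0nil (etrans sz m0)) big_nil /mxtrace big1 // => i _.
  by have := ltn_ord i; rewrite {2}m0.
apply: oppr_inj; rewrite -char_poly_trace // (spectrumP symA).
have -> : m.-1 = (size (spectrum A)).-1 by rewrite sz.
by rewrite coefPn_prod_XsubC // sz -lt0n.
Qed.

Lemma pdmx_shift A t : 0 < t -> psdmx A -> pdmx (1%:M + t *: A).
Proof.
move=> t0 psdA; have := psdmx_det_mono _ _ 1%:M (t *: A).
case=> //; last exact: psdmxZ (ltW t0) psdA.
by split; [exact: psdmx1 | rewrite det1].
Qed.

Lemma sum_ln_spectrum A t : 0 < t -> psdmx A ->
  \sum_(a <- spectrum A) ln (1 + t * a) = ln (\det (1%:M + t *: A)).
Proof.
move=> t0 psdA; rewrite det_spectrum ?gt_eqF //; last exact: psdA.1.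
have pos : {in spectrum A, forall a, 0 < 1 + t * a}.
  by move=> a /(spectrum_ge0 A psdA) a0; rewrite ltr_wpDr // mulr_ge0 // ltW.
elim: (spectrum A) pos => [|a l IH] pos; first by rewrite !big_nil ln1.
have posl : {in l, forall a, 0 < 1 + t * a}.
  by move=> b bl; rewrite pos // in_cons bl orbT.
rewrite !big_cons lnM ?posrE ?pos ?mem_head ?IH // big_seq.
by apply: prodr_gt0 => b /posl.
Qed.

(** The objective as a function of the matrix, so that increments may be arbitrary positive
    semidefinite matrices. *)
Definition specfun (p : R) A : R :=
  if p == 0 then (\rank A)%:R else \sum_(a <- spectrum A) a `^ p.

Lemma specfun_ge0 p A : 0 <= specfun p A.
Proof.
rewrite /specfun; case: ifP => // _.
by rewrite sumr_ge0 // => a _; rewrite powR_ge0.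
Qed.

Lemma specfun1 A : psdmx A -> specfun 1 A = \tr A.
Proof.
move=> psdA; rewrite /specfun oner_eq0 -sum_spectrum; last exact: psdA.1.
rewrite big_seq [RHS]big_seq; apply: eq_bigr => a.
by move=> /(spectrum_ge0 A psdA) /powRr1.
Qed.

Lemma mxtrace_psdmx_ge0 A : psdmx A -> 0 <= \tr A.
Proof.
move=> psdA; rewrite sumr_ge0 // => i _.
by rewrite -bform_delta psdmx_bform_ge0.
Qed.

Lemma specfun_mono p A B : 0 <= p <= 1 -> psdmx A -> psdmx B ->
  specfun p A <= specfun p (A + B).
Proof.
move=> /andP[p0 p1] psdA psdB; have psdAB := psdmxD _ _ A B psdA psdB.
have [->|p_neq0] := eqVneq p 0.
  by rewrite /specfun eqxx ler_nat rank_psdmx_mono.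
have [->|p_neq1] := eqVneq p 1.
  by rewrite !specfun1 // mxtraceD lerDl mxtrace_psdmx_ge0.
rewrite /specfun (negbTE p_neq0); apply: sum_powR_le.
- by rewrite lt_neqAle eq_sym p_neq0 p0 lt_neqAle p_neq1 p1.
- exact: spectrum_ge0.
- exact: spectrum_ge0.
move=> t t0; rewrite !sum_ln_spectrum // scalerDr addrA.
have pdA := pdmx_shift A t t0 psdA.
have psdtB := psdmxZ _ _ _ B (ltW t0) psdB.
have [pdAB le_det] := psdmx_det_mono _ _ _ _ pdA psdtB.
by rewrite ler_ln ?posrE //; [exact: pdA.2 | exact: pdAB.2].
Qed.

Lemma specfun_submodular p A B C : 0 <= p <= 1 ->
  psdmx A -> psdmx B -> psdmx C ->
  specfun p (A + B + C) + specfun p A <= specfun p (A + B) + specfun p (A + C).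
Proof.
move=> /andP[p0 p1] psdA psdB psdC.
have psdAB := psdmxD _ _ A B psdA psdB.
have psdAC := psdmxD _ _ A C psdA psdC.
have psdABC := psdmxD _ _ _ C psdAB psdC.
have [->|p_neq0] := eqVneq p 0.
  by rewrite /specfun eqxx -!natrD ler_nat rank_psdmx_submodular.
have [->|p_neq1] := eqVneq p 1.
  by rewrite !specfun1 // !mxtraceD; lra.
(* Concatenating the two spectra on each side turns the claim into a single comparison of power
   sums. *)
rewrite /specfun (negbTE p_neq0) -!big_cat /=; apply: sum_powR_le.
- by rewrite lt_neqAle eq_sym p_neq0 p0 lt_neqAle p_neq1 p1.
- by move=> a; rewrite mem_cat => /orP[]; apply: spectrum_ge0.
- by move=> a; rewrite mem_cat => /orP[]; apply: spectrum_ge0.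
move=> t t0; rewrite !big_cat /= !sum_ln_spectrum // !scalerDr !addrA.
have psdtB := psdmxZ _ _ _ B (ltW t0) psdB.
have psdtC := psdmxZ _ _ _ C (ltW t0) psdC.
have pdA := pdmx_shift A t t0 psdA.
have [pdAB _] := psdmx_det_mono _ _ _ _ pdA psdtB.
have [pdAC _] := psdmx_det_mono _ _ _ _ pdA psdtC.
have [pdABC _] := psdmx_det_mono _ _ _ _ pdAB psdtC.
rewrite -!lnM ?posrE ?pdA.2 ?pdAB.2 ?pdAC.2 ?pdABC.2 //.
rewrite ler_ln ?posrE ?mulr_gt0 ?pdA.2 ?pdAB.2 ?pdAC.2 ?pdABC.2 //.
exact: det_submodular.
Qed.

End SpectralSums.

Arguments specfun {R m}.

(** * The greedy algorithm *)

Section Greedy.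

Variables (R : realType) (m s : nat) (M : 'I_s -> 'M[R]_m) (p : R).
Hypotheses (psdM : forall i, psdmx (M i)) (p01 : 0 <= p <= 1).

Lemma phiE n : phi M p n = specfun p (weighted_sum M n).
Proof. by []. Qed.

Lemma psdmx_weighted_sum n : psdmx (weighted_sum M n).
Proof.
apply: big_ind => [|A B|i _]; [exact: psdmx0 | exact: psdmxD |].
by elim: (n i) => [|k IH]; [exact: psdmx0 | rewrite mulrSr; apply: psdmxD].
Qed.

(** The matrices are added one copy at a time; by submodularity each copy gains no more than it
    would when added to A alone. *)
Lemma specfun_add_le A d n : psdmx A ->
  (forall i, specfun p (A + M i) <= specfun p A + d) ->
  specfun p (A + weighted_sum M n)
  <= specfun p A + (\sum_(i < s) n i)%:R * d.
Proof.
move=> psdA gain.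
pose K (B : 'M[R]_m) (k : nat) := psdmx B /\
  specfun p (A + B) <= specfun p A + k%:R * d.
have KD B k l i : K B k -> K (B + M i *+ l) (l + k)%N.
  move=> KB; elim: l => [|l [psdBl IH]]; first by rewrite addr0.
  rewrite mulrSr addrA addSn; split; first exact: psdmxD.
  rewrite addrA -natr1 mulrDl mul1r.
  have := specfun_submodular _ _ p A _ (M i) p01 psdA psdBl (psdM i).
  by have := gain i; lra.
suff [] : K (weighted_sum M n) (\sum_(i < s) n i)%N by [].
rewrite /weighted_sum; elim/big_rec2: _ => [|i k B _ KB].
  by split; [exact: psdmx0 | rewrite addr0 mul0r addr0].
by rewrite addrC; apply: KD.
Qed.

Variable N : nat.

Lemma weighted_sum_copies (S : {set 'I_s * 'I_N}) :
  weighted_sum M (copies S) = \sum_(e in S) M e.1.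
Proof.
rewrite (partition_big (fun e => e.1) xpredT) //=; apply: eq_bigr => i _.
rewrite ffunE (eq_bigr (fun=> M i)) => [|e /andP[_ /eqP->] //].
by rewrite sumr_const; congr (_ *+ _); apply: eq_card => e; rewrite !inE.
Qed.

Lemma weighted_sum_copiesU1 (S : {set 'I_s * 'I_N}) e : e \notin S ->
  weighted_sum M (copies (e |: S)) = weighted_sum M (copies S) + M e.1.
Proof. by move=> eS; rewrite !weighted_sum_copies big_setU1 //= addrC. Qed.

(** Before step N no index is exhausted, so the greedy choice is compared with every index. *)
Lemma pool_fresh (S : {set 'I_s * 'I_N}) (i : 'I_s) :
  (#|S| < N)%N -> exists j, (i, j) \notin S.
Proof.
move=> SN; apply/existsP; apply: contraLR SN.
rewrite negb_exists => /forallP allS; rewrite -leqNgt.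
have inj : injective (fun j : 'I_N => (i, j)) by move=> j k [].
rewrite -[N in (N <= _)%N]card_ord -(card_imset predT inj).
apply/subset_leq_card/fintype.subsetP => _ /imsetP[j _ ->].
by have := allS j; rewrite negbK.
Qed.

Lemma greedy_card k (G : {set 'I_s * 'I_N}) : greedy M p k G -> #|G| = k.
Proof. by elim=> [|{}k {}G e _ <- eG _]; rewrite ?cards0 // cardsU1 eG. Qed.

Lemma greedy_gap k (G : {set 'I_s * 'I_N}) (n : {ffun 'I_s -> nat}) :
  (\sum_(i < s) n i <= N)%N -> greedy M p k G -> (k <= N)%N ->
  phi M p n - phi_set M p G <= (1 - N%:R^-1) ^+ k * phi M p n.
Proof.
move=> nN; elim=> [|{}k {}G e grG IH eG emax] kN.
  by rewrite expr0 mul1r lerBlDr lerDl specfun_ge0.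
have N0 : (0 : R) < N%:R by rewrite ltr0n (leq_trans _ kN).
set f := phi M p n in IH *.
set g := phi_set M p G in IH *; set g' := phi_set M p (e |: G).
have psdG := psdmx_weighted_sum (copies G).
have gain i : specfun p (weighted_sum M (copies G) + M i) <= g + (g' - g).
  have [|j ijG] := pool_fresh G i; first by rewrite (greedy_card _ _ grG).
  rewrite [g + _]addrC subrK; apply: le_trans (emax (i, j) ijG).
  by rewrite /phi_set phiE weighted_sum_copiesU1.
have g'g : 0 <= g' - g.
  rewrite subr_ge0 /g' /g /phi_set !phiE weighted_sum_copiesU1 //.
  exact: specfun_mono.
(* By monotonicity f is at most the value of n added to the current state, and each of its at most N
   copies gains at most g' - g. *)
have fle : f <= g + N%:R * (g' - g).
  apply: (@le_trans _ _ (g + (\sum_(i < s) n i)%:R * (g' - g))).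
    apply: le_trans (specfun_add_le _ _ n psdG gain).
    rewrite addrC /f phiE; apply: specfun_mono => //.
    exact: psdmx_weighted_sum.
  by rewrite lerD2l ler_wpM2r // ler_nat.
have IH' := IH (ltnW kN); rewrite exprS -mulrA.
apply: le_trans (_ : (1 - N%:R^-1) * (f - g) <= _); last first.
  rewrite ler_wpM2l // subr_ge0 invf_le1 // ler1n (leq_trans _ kN) //.
have : N%:R^-1 * (f - g) <= g' - g by rewrite ler_pdivrMl //; lra.
lra.
Qed.

(** Every entry of a feasible vector is at most N, so the maximum is taken over a finite type. *)
Lemma phi_max_exists : exists2 n : {ffun 'I_s -> nat},
  (\sum_(i < s) n i <= N)%N &
  forall n' : {ffun 'I_s -> nat}, (\sum_(i < s) n' i <= N)%N ->
    phi M p n' <= phi M p n.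
Proof.
pose val_ffun (h : {ffun 'I_s -> 'I_N.+1}) : {ffun 'I_s -> nat} :=
  [ffun i => h i : nat].
pose P h := (\sum_(i < s) val_ffun h i <= N)%N.
have P0 : P [ffun=> ord0] by rewrite /P big1 // => i _; rewrite !ffunE.
case: (arg_maxP (fun h => phi M p (val_ffun h)) P0) => h Ph hmax.
exists (val_ffun h) => // n' n'N.
have n'lt i : (n' i < N.+1)%N.
  by rewrite ltnS (leq_trans _ n'N) // (bigD1 i) //= leq_addr.
have [h' n'E] : exists h', n' = val_ffun h'.
  by exists [ffun i => Ordinal (n'lt i)]; apply/ffunP => i; rewrite !ffunE.
by rewrite n'E; apply: hmax; rewrite /P -n'E.
Qed.

End Greedy.

Theorem theorem2p6 (R : realType) (m s N : nat) (M : 'I_s -> 'M[R]_m) (p : R)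
    (psdM : forall i : 'I_s, psdmx (M i))
    (N_ge1 : (1 <= N)%N)
    (p_ge0 : 0 <= p) (p_le1 : p <= 1)
    (G : {set 'I_s * 'I_N}) (greedyG : greedy M p N G) :
  exists opt : R,
    is_max (phi M p @` feasible s N)%classic opt /\
    (1 - 1 / expR 1) * opt <= phi_set M p G.
Proof.
have p01 : 0 <= p <= 1 by rewrite p_ge0.
have [n nN nmax] := phi_max_exists R m s M p N.
exists (phi M p n); split.
  by split; [exists n | move=> _ [n' n'N <-]; exact: nmax].
have f0 : 0 <= phi M p n by exact: specfun_ge0.
have N0 : (0 : R) < N%:R by rewrite ltr0n.
have := greedy_gap R m s M p psdM p01 N N G n nN greedyG (leqnn N).
have le_e : (1 - N%:R^-1) ^+ N <= 1 / expR 1 :> R.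
  have -> : 1 / expR 1 = expR (- N%:R^-1) ^+ N :> R.
    (* Writing 1 / e as an N-th power reduces the bound to 1 - 1/N <= exp (- 1/N), where both sides
       are nonnegative since N >= 1. *)
    by rewrite -expRM_natl mulrN mulfV ?gt_eqF // expRN mul1r.
  apply: lerXn2r; rewrite ?nnegrE ?expR_ge0 //; last exact: expR_ge1Dx.
  by rewrite subr_ge0 invf_le1 // ler1n.
have := ler_wpM2r f0 le_e; lra.
Qed.
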